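(* The forgetful functor $T':\mathcal{S}'\to\mathcal{T}'$, sending a compactly flowing stream to its underlying compactly generated space, is topological.
   Context: A preorder is a reflexive and transitive relation. For a relation $R$ on a set $X$, $\mathrm{graph}(R)=\{(x,y)\in X\times X : x\,R\,y\}$. For a family $\{(A_i,\leqslant_{i})\}_{i}$ of preordered sets, $\bigvee_{i}\leqslant_{i}$ denotes the preorder on $\bigcup_i A_i$ that is the transitive-reflexive closure of the relation with graph $\bigcup_{i}\mathrm{graph}(\leqslant_{i})$. A circulation $\leqslant$ on a space $X$ is a function assigning to each open subset $U\subset X$ a preorder $\leqslant_U$ on $U$ such that $\leqslant_{\bigcup\mathcal{O}}=\bigvee_{U\in\mathcal{O}}\leqslant_U$ for each collection $\mathcal{O}$ of open subsets of $X$. A stream $(X,\leqslant)$ is a space $X$ with a circulation on it. A stream map $f:(X,\leqslant)\to(Y,\leqslant')$ is a continuous function $f:X\to Y$ such that, for all open $U\subset Y$, $f(x)\leqslant'_U f(y)$ whenever $x\leqslant_{f^{-1}U}y$. A precirculation $\leqslant$ on $X$ assigns to each open $U\subset X$ a preorder $\leqslant_U$ on $U$ with $\mathrm{graph}(\leqslant_U)\subset\mathrm{graph}(\leqslant_V)$ whenever $U\subset V$ (every circulation is one). For a continuous $f:X\to Y$ and a precirculation $\leqslant$ on $Y$, the pullback $\leqslant^{f^*}$ is the precirculation on $X$ with $\mathrm{graph}(\leqslant^{f^*}_U)=(U\times U)\cap\bigcap_{V}(f\times f)^{-1}(\mathrm{graph}(\leqslant_V))$, the intersection over all open $V\subset Y$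 with $f(U)\subset V$. The cosheafification $\leqslant^!$ of a precirculation $\leqslant$ on $X$ is the circulation with $\leqslant^!_U=\bigvee\leqslant'_U$, the join over all circulations $\leqslant'$ on $X$ such that $\mathrm{graph}(\leqslant'_W)\subset\mathrm{graph}(\leqslant_W)$ for all open $W\subset X$. For a stream $(X,\leqslant)$ and a subspace $A\subset X$, the substream on $A$ is $(A,(\leqslant^{(A\hookrightarrow X)^*})^!)$, and $\leqslant_{\restriction A}$ denotes the preorder $(\leqslant^{(A\hookrightarrow X)^*})^!_A$ on $A$. A space $X$ is weak Hausdorff if images in $X$ of continuous functions from compact Hausdorff spaces are closed; $X$ is compactly generated if it is weak Hausdorff and a subset $U\subset X$ is open whenever $U\cap K$ is open in $K$ for all compact Hausdorff subspaces $K\subset X$. For a weak Hausdorff space $X$, let $\mathcal{K}(X)$ be the family of compact Hausdorff subsets of $X$. A circulation $\leqslant$ on $X$ is a k-circulation if $\leqslant_U=\bigvee_{L\in\mathcal{K}(U)}\leqslant_{\restriction L}$ for all open $U\subset X$. A stream $(X,\leqslant)$ is compactly flowing if $X$ is compactly generated and $\leqslant$ is a k-circulation. $\mathcal{S}'$ is the category of compactly flowing streams and stream maps; $\mathcal{T}'$ is the category of compactly generated spaces and continuous functions. For a functor $F:\mathcal{C}_1\to\mathcal{C}_2$, a functor $D:\mathcal{D}\to\mathcal{C}_1$ and a cone $\bar\lambda=(\bar\lambda_x:\bar c\to FDx)_{x\in\mathrm{ob}\,\mathcal{D}}$ on $FD$, an initial structure for $(F,D,\bar\lambda)$ is a cone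 $\lambda=(\lambda_x:c\to Dx)_{x\in\mathrm{ob}\,\mathcal{D}}$ on $D$ such that $F\lambda=\bar\lambda$ and, for each cone $\lambda'$ from a $\mathcal{C}_1$-object $c'$ to $D$, every $\mathcal{C}_2$-map $Fc'\to Fc$ through which $F\lambda'$ factors through $F\lambda$ has a unique preimage $c'\to c$ under $F$ through which $\lambda'$ factors through $\lambda$. The functor $F$ is topological if an initial structure exists for all such data $(F,D,\bar\lambda)$. *)

(* Defs.v *)
From HB Require Import structures.
From mathcomp Require Import all_boot.
From mathcomp Require Import all_classical topology.
From Stdlib Require Import Relation_Operators.

Set Implicit Arguments.
Unset Strict Implicit.
Unset Printing Implicit Defensive.

Local Open Scope classical_set_scope.

Record category := Category {
  obj :> Type;
  hom : obj -> obj -> Type;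
  idm : forall a, hom a a;
  comp : forall a b c, hom b c -> hom a b -> hom a c;
  comp_idl : forall a b (f : hom a b), comp (idm b) f = f;
  comp_idr : forall a b (f : hom a b), comp f (idm a) = f;
  compA : forall a b c d (h : hom c d) (g : hom b c) (f : hom a b),
    comp h (comp g f) = comp (comp h g) f }.

Arguments hom {_} _ _.
Arguments idm {_} _.
Arguments comp {_ _ _ _} _ _.

Record functor (C D : category) := Functor {
  fobj :> C -> D;
  fmap : forall a b : C, hom a b -> hom (fobj a) (fobj b);
  fmap_id : forall a : C, fmap (idm a) = idm (fobj a);
  fmap_comp : forall (a b c : C) (g : hom b c) (f : hom a b),
    fmap (comp g f) = comp (fmap g) (fmap f) }.

Arguments fmap {_ _} _ {_ _} _.

Section FunctorComposition.
Variables (B C D : category) (F : functor C D) (G : functor B C).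

Let cmap (a b : B) (f : hom a b) : hom (F (G a)) (F (G b)) := fmap F (fmap G f).

Lemma fcomp_id (a : B) : cmap (idm a) = idm (F (G a)).
Proof. by rewrite /cmap !fmap_id. Qed.

Lemma fcomp_comp (a b c : B) (g : hom b c) (f : hom a b) :
  cmap (comp g f) = comp (cmap g) (cmap f).
Proof. by rewrite /cmap !fmap_comp. Qed.

Definition fcomp : functor B D := Functor fcomp_id fcomp_comp.

End FunctorComposition.

Record cone (J C : category) (D : functor J C) := Cone {
  apex : C;
  leg : forall j : J, hom apex (D j);
  leg_natural : forall (i j : J) (u : hom i j), comp (fmap D u) (leg i) = leg j }.

Arguments leg {_ _ _} _ _.

Section MapCone.
Variables (J C1 C2 : category) (F : functor C1 C2) (D : functor J C1).

Lemma map_cone_natural (l : cone D) (i j : J) (u : hom i j) :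
  comp (fmap (fcomp F D) u) (fmap F (leg l i)) = fmap F (leg l j).
Proof. by rewrite /= -fmap_comp leg_natural. Qed.

Definition map_cone (l : cone D) : cone (fcomp F D) :=
  @Cone _ _ (fcomp F D) (F (apex l)) (fun j => fmap F (leg l j))
    (map_cone_natural l).

(* The equation [map_cone l = lbar] is equality of cones: it comprises the
   equality of objects [F (apex l) = apex lbar]. *)
Definition initial_structure (lbar : cone (fcomp F D)) (l : cone D) : Prop :=
  map_cone l = lbar /\
  forall (l' : cone D) (g : hom (F (apex l')) (F (apex l))),
    (forall j : J, fmap F (leg l' j) = comp (fmap F (leg l j)) g) ->
    exists! h : hom (apex l') (apex l),
      fmap F h = g /\ forall j : J, leg l' j = comp (leg l j) h.

End MapCone.

(* [J] ranges over categories that may be as large as [C1] and [C2]. *)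
Definition topological_functor (C1 C2 : category) (F : functor C1 C2) : Prop :=
  forall (J : category) (D : functor J C1) (lbar : cone (fcomp F D)),
    exists l : cone D, initial_structure lbar l.

(* A relation on a subset [A] of [X] is represented by its graph in [X * X]. *)
Definition preorder_on (X : Type) (A : set X) (R : X -> X -> Prop) : Prop :=
  [/\ forall x y, R x y -> A x /\ A y,
      forall x, A x -> R x x &
      forall x y z, R x y -> R y z -> R x z].

(* The join of the preorders [R i] on [A i], for [i] in [P]; it lives on
   the union [B], outside of which [clos_refl_trans] still relates x to x. *)
Definition join (X I : Type) (P : set I) (A : I -> set X)
    (R : I -> X -> X -> Prop) (x y : X) : Prop :=
  let B := \bigcup_(i in P) A i in
  [/\ B x, B y &
      clos_refl_trans X (fun a b => exists2 i, P i & R i a b) x y].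

Lemma join_preorder (X I : Type) (P : set I) (A : I -> set X)
  (R : I -> X -> X -> Prop) : preorder_on (\bigcup_(i in P) A i) (join P A R).
Proof.
split.
- by move=> x y [].
- by move=> x Bx; split=> //; exact: rt_refl.
- move=> x y z [a b c] [d e f]; split=> //; exact: (rt_trans _ _ _ y).
Qed.

Record opens (X : topologicalType) := Opens {
  opens_set :> set X;
  opens_open : open opens_set }.

Lemma opens_eq (X : topologicalType) (U V : opens X) :
  (U : set X) = V -> U = V.
Proof.
case: U V => [U oU] [V oV] /= UV; subst V.
by congr Opens; exact: Prop_irrelevance.
Qed.

Definition opens_full (X : topologicalType) : opens X := Opens (@openT X).

Definition opens_bigcup (X : topologicalType) (O : set (opens X)) : opens X :=
  Opens (bigcup_open (fun (U : opens X) (_ : O U) => opens_open U)).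

Lemma opens_preimage_open (X Y : topologicalType) (f : continuousType X Y)
  (U : opens Y) : open (f @^-1` U).
Proof.
by apply: open_comp (opens_open U) => x _; apply: (@cts_fun _ _ f).
Qed.

Definition opens_preimage (X Y : topologicalType) (f : continuousType X Y)
  (U : opens Y) : opens X := Opens (opens_preimage_open f U).

Definition rel_family (X : topologicalType) := opens X -> X -> X -> Prop.

Definition rel_family_le (X : topologicalType) (le1 le2 : rel_family X) :=
  forall U x y, le1 U x y -> le2 U x y.

Definition precirculation (X : topologicalType) (le : rel_family X) : Prop :=
  (forall U : opens X, preorder_on U (le U)) /\
  (forall U V : opens X, U `<=` V -> forall x y, le U x y -> le V x y).

Definition circulation (X : topologicalType) (le : rel_family X) : Prop :=
  (forall U : opens X, preorder_on U (le U)) /\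
  (forall (O : set (opens X)) x y,
     le (opens_bigcup O) x y <-> join O (@opens_set X) le x y).

Lemma circulation_precirculation (X : topologicalType) (le : rel_family X) :
  circulation le -> precirculation le.
Proof.
move=> [p c]; split=> // U V UV x y lxy.
have [] := p U => /(_ _ _ lxy) [Ux Uy] _ _.
have E : V = opens_bigcup [set W | W = U \/ W = V].
  apply: opens_eq; apply/seteqP; split=> [z Vz|z [W [->|->]]] //=.
  - by exists V => //; right.
  - exact: UV.
rewrite E; apply/c; split.
- by exists U => //; left.
- by exists U => //; left.
- by apply: rt_step; exists U => //; left.
Qed.

Definition pullback (X Y : topologicalType) (f : X -> Y) (le : rel_family Y) :
    rel_family X :=
  fun U x y => [/\ opens_set U x, opens_set U y &
    forall V : opens Y, f @` U `<=` V -> le V (f x) (f y)].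

Lemma pullback_precirculation (X Y : topologicalType) (f : X -> Y)
  (le : rel_family Y) : precirculation le -> precirculation (pullback f le).
Proof.
move=> [p m]; split.
  move=> U; split.
  - by move=> x y [].
  - move=> x Ux; split=> // V UV; have [_ r _] := p V; apply: r.
    by apply: UV; exists x.
  - move=> x y z [a b c] [d e g]; split=> // V UV; have [_ _ t] := p V.
    exact: (t _ _ _ (c V UV) (g V UV)).
move=> U V UV x y [a b c]; split; [exact: UV|exact: UV|move=> W VW].
by apply: c => z [t Ut <-]; apply: VW; exists t => //; exact: UV.
Qed.

Definition cosheafification (X : topologicalType) (le : rel_family X) :
    rel_family X :=
  fun U => join [set le' | circulation le' /\ rel_family_le le' le]
    (fun=> U : set X) (fun le' => le' U).

Lemma cosheafification_circulation (X : topologicalType) (le : rel_family X) :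
  precirculation le -> circulation (cosheafification le).
Proof.
move=> [p m].
pose disc : rel_family X := fun U x y => opens_set U x /\ x = y.
have dc : circulation disc.
  split=> [U|O x y].
    split=> [x y []Ux <- //|x Ux|x y z [a <-] [b <-]]; split=> //.
  split; first by move=> [Ux <-]; split=> //; exact: rt_refl.
  move=> -[Bx By h]; split=> //.
  elim: h {Bx By} => [a b [i _ [_ ->]] //|//|a b c _ -> _ -> //].
have dl : rel_family_le disc le.
  by move=> U x y [Ux <-]; have [_ r _] := p U; exact: r.
split.
  move=> U; have [a b c] := @join_preorder X _
    [set le' | circulation le' /\ rel_family_le le' le]
    (fun=> opens_set U) (fun le' => le' U).
  split=> //.
    by move=> x y /a [[? _ ?] [? _ ?]].
  by move=> x Ux; apply: b; exists disc.
move=> O x y; split.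
  move=> [[l1 _ Ox] [l2 _ Oy] h]; split=> //.
  elim: h {Ox Oy} => [a b [l [lc ll] lab]|a|a b c _ ab _ bc]; last 2 first.
  - exact: rt_refl.
  - exact: (rt_trans _ _ _ b).
  have [_ q] := lc; have /q [_ _] := lab.
  move: (a) (b) => a' b'; clear a b lab.
  elim=> [a b [U OU lU]|?|? d ? _ ? _ ?]; last 2 first.
  - exact: rt_refl.
  - exact: (rt_trans _ _ _ d).
  apply: rt_step; exists U => //.
  have [q1 _] := lc; have [] := q1 U => /(_ _ _ lU)[Ua Ub] _ _.
  by split; [exists disc|exists disc|apply: rt_step; exists l].
move=> [Bx By h]; split; [by exists disc|by exists disc|].
elim: h {Bx By} => [a0 b0 [U OU [_ _]]|a|a b c _ ab _ bc]; last 2 first.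
- exact: rt_refl.
- exact: (rt_trans _ _ _ b).
elim=> [a b [l [lc ll] lU]|?|? d ? _ ? _ ?]; last 2 first.
- exact: rt_refl.
- exact: (rt_trans _ _ _ d).
apply: rt_step; exists l => //.
have [_ mm] := circulation_precirculation lc; apply: (mm U) lU => z Uz; by exists U.
Qed.

(* The coercion of [A : set X] to a type carries the subspace topology. *)
Definition substream_circ (X : topologicalType) (le : rel_family X)
    (A : set X) : rel_family A :=
  cosheafification (pullback (set_val : A -> X) le).

Lemma substream_circ_circulation (X : topologicalType) (le : rel_family X)
  (A : set X) : circulation le -> circulation (@substream_circ X le A).
Proof.
move=> cle; apply: cosheafification_circulation.
exact/pullback_precirculation/circulation_precirculation.
Qed.

Definition restrict (X : topologicalType) (le : rel_family X) (A : set X)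
    (x y : X) : Prop :=
  exists a b : A, [/\ set_val a = x, set_val b = y &
    substream_circ le (opens_full A) a b].

Definition compact_hausdorff (K : topologicalType) : Prop :=
  compact [set: K] /\ hausdorff_space K.

Definition weak_hausdorff (X : topologicalType) : Prop :=
  forall (K : topologicalType) (f : K -> X),
    compact_hausdorff K -> continuous f -> closed (range f).

Definition compactly_generated (X : topologicalType) : Prop :=
  weak_hausdorff X /\
  forall U : set X,
    (forall K : set X, compact_hausdorff K ->
       open ((set_val : K -> X) @^-1` U)) ->
    open U.

(* A subset of [A] has the same subspace topology in [A] and in [X], so these
   are the compact Hausdorff subsets of the subspace [A]. *)
Definition compact_hausdorff_subsets (X : topologicalType) (A : set X) :
    set (set X) :=
  [set L | L `<=` A /\ compact_hausdorff L].

Definition k_circulation (X : topologicalType) (le : rel_family X) : Prop :=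
  circulation le /\
  forall (U : opens X) x y,
    le U x y <-> join (compact_hausdorff_subsets U) id (restrict le) x y.

Record stream := Stream {
  stream_space :> topologicalType;
  stream_circ : rel_family stream_space;
  stream_circP : circulation stream_circ }.

Definition compactly_flowing (S : stream) : Prop :=
  compactly_generated S /\ k_circulation (@stream_circ S).

Definition is_stream_map (S T : stream) (f : continuousType S T) : Prop :=
  forall (U : opens T) x y,
    stream_circ (opens_preimage f U) x y -> stream_circ U (f x) (f y).

Record cg_space := CGSpace {
  cg_top :> topologicalType;
  cg_topP : compactly_generated cg_top }.

Definition cts_id (X : topologicalType) : continuousType X X := idfun.

Definition cts_comp (X Y Z : topologicalType) (g : continuousType Y Z)
  (f : continuousType X Y) : continuousType X Z := g \o f.

Lemma cts_comp_idl (X Y : topologicalType) (f : continuousType X Y) :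
  cts_comp (cts_id Y) f = f.
Proof. exact/continuousEP. Qed.

Lemma cts_comp_idr (X Y : topologicalType) (f : continuousType X Y) :
  cts_comp f (cts_id X) = f.
Proof. exact/continuousEP. Qed.

Lemma cts_compA (X Y Z W : topologicalType) (h : continuousType Z W)
  (g : continuousType Y Z) (f : continuousType X Y) :
  cts_comp h (cts_comp g f) = cts_comp (cts_comp h g) f.
Proof. exact/continuousEP. Qed.

Definition CGSpaces : category := @Category cg_space
  (fun X Y => continuousType X Y)
  (fun X => cts_id X) (fun X Y Z => @cts_comp X Y Z)
  (fun X Y => @cts_comp_idl X Y) (fun X Y => @cts_comp_idr X Y)
  (fun X Y Z W => @cts_compA X Y Z W).

Record cf_stream := CFStream {
  cf_base :> stream;
  cf_baseP : compactly_flowing cf_base }.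

Record stream_map (S T : stream) := StreamMap {
  smap_fun :> continuousType S T;
  smap_funP : is_stream_map smap_fun }.

Lemma stream_map_eq (S T : stream) (f g : stream_map S T) :
  smap_fun f = smap_fun g -> f = g.
Proof.
case: f g => [f fP] [g gP] /= fg; subst g.
by congr StreamMap; exact: Prop_irrelevance.
Qed.

Lemma smap_idP (S : stream) : is_stream_map (cts_id S).
Proof.
move=> U x y; suff -> : opens_preimage (cts_id S) U = U by [].
exact: opens_eq.
Qed.

Definition smap_id (S : stream) : stream_map S S := StreamMap (@smap_idP S).

Lemma smap_compP (S T V : stream) (g : stream_map T V) (f : stream_map S T) :
  is_stream_map (cts_comp g f).
Proof.
move=> U x y Sxy; apply: (smap_funP (s := g)); apply: (smap_funP (s := f)).
by congr (stream_circ _ x y) : Sxy; exact: opens_eq.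
Qed.

Definition smap_comp (S T V : stream) (g : stream_map T V)
  (f : stream_map S T) : stream_map S V := StreamMap (@smap_compP S T V g f).

Lemma smap_comp_idl (S T : stream) (f : stream_map S T) :
  smap_comp (smap_id T) f = f.
Proof. exact/stream_map_eq/cts_comp_idl. Qed.

Lemma smap_comp_idr (S T : stream) (f : stream_map S T) :
  smap_comp f (smap_id S) = f.
Proof. exact/stream_map_eq/cts_comp_idr. Qed.

Lemma smap_compA (S T V W : stream) (h : stream_map V W) (g : stream_map T V)
  (f : stream_map S T) :
  smap_comp h (smap_comp g f) = smap_comp (smap_comp h g) f.
Proof. exact/stream_map_eq/cts_compA. Qed.

Definition CFStreams : category := @Category cf_stream
  (fun S T => stream_map S T)
  (fun S => smap_id S) (fun S T V => @smap_comp S T V)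
  (fun S T => @smap_comp_idl S T) (fun S T => @smap_comp_idr S T)
  (fun S T V W => @smap_compA S T V W).

Definition forgetful : functor CFStreams CGSpaces :=
  @Functor CFStreams CGSpaces
    (fun S : cf_stream => CGSpace (proj1 (cf_baseP S)))
    (fun S T (f : stream_map S T) => smap_fun f)
    (fun S => erefl) (fun S T V g f => erefl).

(* Main.v *)
From mathcomp Require Import all_boot.
From mathcomp Require Import all_classical topology.
From Stdlib Require Import Relation_Operators.
Require Import Defs.

Set Implicit Arguments.
Unset Strict Implicit.
Unset Printing Implicit Defensive.

Local Open Scope classical_set_scope.

(** Given a compactly generated space [X] and continuous maps [f j] from [X] to
    compactly flowing streams, the initial structure on [X] is the largest
    k-circulation that makes every [f j] a stream map.  A circulation makes
    [f j] a stream map exactly when it is contained in the pullback along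
    [f j], so the candidate is the join of all k-circulations contained in
    every such pullback.

    This join is again a k-circulation ([circ_join_k_circulation]).  The point
    is that, for a circulation on [X], the preorder induced on a subspace
    [L] of [U] is always contained in the preorder on [U] ([restrict_sub]);
    only the inclusion of the preorder on [U] in the join over compact
    Hausdorff [L] has to be checked, and that inclusion passes to joins because
    restriction to [L] is monotone.

    For universality, let [g : S -> X] be continuous and such that each
    [f j \o g] is a stream map.  The pushforward of the circulation of [S]
    along [g] is contained in every pullback, so if it is a k-circulation
    then it is one of the circulations being joined, and [g] is a stream map.
    That pushforward preserves k-circulations
    ([pushforward_k_circulation]) is the place where weak Hausdorffness of
    [X] enters: a compact Hausdorff subset [L] of [S] has compact Hausdorff
    image ([compact_hausdorff_image]), and the substream on [L] pushes forward
    to a circulation on [g @` L] that witnesses the required relations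
    ([pushforward_restrict]). *)

(** * Compact Hausdorff subsets of weak Hausdorff spaces *)

Lemma compact_subtype (X : topologicalType) (A : set X) :
  compact A -> compact [set: A].
Proof.
move=> cA F FF _.
have GA : (set_val @ F) A.
  apply: (@filterS _ F _ [set: A]); last exact: filterT.
  by move=> a _; exact: (set_valP a).
have [x [Ax clx]] := cA _ (fmap_proper_filter _ FF) GA.
exists (SigSub (mem_set Ax)); split=> // B C FB.
case=> _ /= [[W oW <-] /= Wx sWC].
have FvB : (set_val @ F) (set_val @` B).
  by apply: (@filterS _ F _ B) => // b Bb /=; exists b.
have [_ [[b Bb <-] Wb]] := clx _ _ FvB (open_nbhs_nbhs (conj oW Wx)).
by exists b; split=> //; exact: sWC.
Qed.

Lemma hausdorff_subtype (X : topologicalType) (A : set X) :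
  hausdorff_space X -> hausdorff_space A.
Proof.
move=> hX a b clab; apply: val_inj; apply: hX => U V nU nV.
have sv : continuous (set_val : A -> X) := @initial_continuous _ _ _.
have [c [Uc Vc]] := clab _ _ (sv a U nU) (sv b V nV).
by exists (set_val c).
Qed.

Lemma compact_hausdorff_closed_subtype (K : topologicalType) (C : set K) :
  compact_hausdorff K -> closed C -> compact_hausdorff C.
Proof.
move=> [cK hK] cC; split; last exact: hausdorff_subtype.
exact/compact_subtype/(subclosed_compact cC cK).
Qed.

Lemma compact_hausdorff_set1 (X : topologicalType) (x : X) :
  compact_hausdorff ([set x] : set X).
Proof.
split; first exact/compact_subtype/compact_set1.
move=> a b _; apply: val_inj.
by rewrite /= (set_valP a : val a = x) (set_valP b : val b = x).
Qed.

Lemma range_set_val (X Y : topologicalType) (A : set X) (f : X -> Y) :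
  range (f \o (set_val : A -> X)) = f @` A.
Proof.
apply/seteqP; split=> [_ [a _ <-]|_ [x Ax <-]].
  by exists (set_val a) => //; exact: set_valP.
by exists (SigSub (mem_set Ax)).
Qed.

Lemma continuous_set_val (X Y : topologicalType) (A : set X) (f : X -> Y) :
  continuous f -> continuous (f \o (set_val : A -> X)).
Proof.
move=> cf a; apply: continuous_comp; [exact: initial_continuous|exact: cf].
Qed.

(** A singleton is the range of its own inclusion, and it is compact
    Hausdorff. *)
Lemma weak_hausdorff_closed1 (X : topologicalType) (x : X) :
  weak_hausdorff X -> closed [set x].
Proof.
move=> wX; rewrite -(image_id [set x]) -[X in closed X]range_set_val.
apply: wX; first exact: compact_hausdorff_set1.
by apply: continuous_set_val => y.
Qed.

(** A closed subset of [K] is itself compact Hausdorff, so its image is the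
    range of a map to which weak Hausdorffness applies. *)
Lemma weak_hausdorff_closed_map (K X : topologicalType) (h : K -> X) :
  weak_hausdorff X -> compact_hausdorff K -> continuous h ->
  forall C, closed C -> closed (h @` C).
Proof.
move=> wX cK ch C cC; rewrite -range_set_val.
apply: wX; first exact: compact_hausdorff_closed_subtype.
exact: continuous_set_val.
Qed.

(** Two points of the range have disjoint closed fibres, which normality of [K]
    separates by open sets.  An open set [W] of [K] gives the open set of
    points whose whole fibre lies in [W], since [h] is a closed map; these
    tubes separate the two points, as no nonempty fibre lies in two disjoint
    sets. *)
Lemma compact_hausdorff_range (K X : topologicalType) (h : K -> X) :
  weak_hausdorff X -> compact_hausdorff K -> continuous h ->
  compact_hausdorff (range h).
Proof.
move=> wX cK ch; have clh := weak_hausdorff_closed_map wX cK ch.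
case: cK => cK hK; split.
  apply: compact_subtype; apply: continuous_compact cK.
  exact: continuous_subspaceT.
rewrite open_hausdorff => a b ab.
have cf x : closed (h @^-1` [set x]).
  by apply: preimage_closed (weak_hausdorff_closed1 wX) => y _; exact: ch.
have [|N /set_nbhsP[U [oU aU UN]] Nb] :=
    compact_normal hK cK (cf (val a)) (t := ~` (h @^-1` [set val b])).
  apply/set_nbhsP; exists (~` (h @^-1` [set val b])); split=> //.
    exact: closed_openC.
  move=> k /= -> /val_inj E; by rewrite E eqxx in ab.
pose V := ~` closure N.
have oV : open V by exact/closed_openC/closed_closure.
pose tube (W : set K) : set (range h) := set_val @^-1` (~` (h @` (~` W))).
have otube W : open W -> open (tube W).
  move=> oW; exists (~` (h @` (~` W))) => //.
  exact/closed_openC/clh/open_closedC.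
exists (tube U, tube V) => /=; first split.
- by rewrite inE => -[k nUk hk]; apply/nUk/aU.
- rewrite inE => -[k nVk hk]; apply: nVk => /Nb; exact.
split; [exact: otube|exact: otube|].
apply/eqP/seteqP; split=> // z [Uz Vz].
have [k _ hk] := set_valP z.
have Uk : U k by apply: contrapT => nUk; apply: Uz; exists k.
by apply: Vz; exists k => // Vk; apply/Vk/subset_closure/UN.
Qed.

Lemma compact_hausdorff_image (X Y : topologicalType) (g : X -> Y) (L : set X) :
  weak_hausdorff Y -> continuous g -> compact_hausdorff L ->
  compact_hausdorff (g @` L).
Proof.
move=> wY cg cL; rewrite -range_set_val.
by apply: compact_hausdorff_range => //; exact: continuous_set_val.
Qed.

(** * Generated preorders and joins *)

(** The membership conditions discard the pairs [(x, x)] that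
    [clos_refl_trans] adds outside [A]; with this form, [join P A R] is
    convertible to a preorder generated on the union of the [A i]. *)
Definition generated (X : Type) (A : set X) (R : X -> X -> Prop) (x y : X) :=
  [/\ A x, A y & clos_refl_trans X R x y].

Lemma generated_preorder (X : Type) (A : set X) (R : X -> X -> Prop) :
  preorder_on A (generated A R).
Proof.
split=> [x y []//|x Ax|x y z [Ax _ xy] [_ Az yz]].
  by split=> //; exact: rt_refl.
by split=> //; exact: rt_trans yz.
Qed.

(** [B] may be larger than [A]: the preorders compared below live on nested
    open sets. *)
Lemma generated_min (X : Type) (A B : set X) (R T : X -> X -> Prop) :
  preorder_on B T -> A `<=` B -> (forall x y, R x y -> T x y) ->
  forall x y, generated A R x y -> T x y.
Proof.
move=> [_ Trefl Ttr] AB RT x y [/AB/Trefl Txx _ xy].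
(* [T] is reflexive on [B] only, so the induction keeps trivial paths apart
   and reflexivity is used at the point [x] of [A] alone. *)
have [<-//|//] : x = y \/ T x y.
elim: xy {Txx} => [a b /RT|a|a b c _ [->|ab] _ [<-|bc]]; [by right|by left| | | |].
- by left.
- by right.
- by right.
- by right; exact: Ttr bc.
Qed.

Lemma join_min (X I : Type) (P : set I) (A : I -> set X)
    (R : I -> X -> X -> Prop) (B : set X) (T : X -> X -> Prop) :
  preorder_on B T -> (forall i, P i -> A i `<=` B) ->
  (forall i, P i -> forall x y, R i x y -> T x y) ->
  forall x y, join P A R x y -> T x y.
Proof.
move=> BT AB RT; apply: generated_min BT _ _; first by move=> x [i /AB]; exact.
by move=> x y [i Pi] /(RT i Pi).
Qed.

Lemma join_incl (X I : Type) (P : set I) (A : I -> set X)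
    (R : I -> X -> X -> Prop) (i : I) (x y : X) :
  P i -> A i x -> A i y -> R i x y -> join P A R x y.
Proof.
by move=> Pi Ax Ay xy; split; [exists i|exists i|apply: rt_step; exists i].
Qed.

Lemma preorder_preimage (X Y : Type) (f : X -> Y) (B : set Y)
    (T : Y -> Y -> Prop) :
  preorder_on B T -> preorder_on (f @^-1` B) (fun x y => T (f x) (f y)).
Proof.
move=> [TB Tr Tt]; split=> [x y /TB//|x /Tr//|x y z].
exact: Tt.
Qed.

(** * Joins of circulations *)

(** The preorder of the substream lies below the pullback along the inclusion
    of [A], and the pullback at [A] itself is an intersection in which [U]
    occurs, because [U] contains [A]. *)
Lemma restrict_sub (X : topologicalType) (le : rel_family X) (A : set X)
    (U : opens X) x y :
  precirculation le -> A `<=` U -> restrict le A x y -> le U x y.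
Proof.
move=> pl AU [a [b [<- <- ab]]].
have pp := pullback_precirculation (set_val : A -> X) pl.
have : pullback (set_val : A -> X) le (opens_full A) a b.
  apply: (join_min (pp.1 (opens_full A))) ab => // l [_]; exact.
by case=> _ _; apply=> _ [c _ <-]; exact/AU/set_valP.
Qed.

(** How elements of [restrict] are produced: cosheafification contains every
    circulation below the precirculation. *)
Lemma restrict_incl (X : topologicalType) (le : rel_family X) (A : set X)
    (m : rel_family A) a b :
  circulation m -> rel_family_le m (pullback set_val le) ->
  m (opens_full A) a b -> restrict le A (set_val a) (set_val b).
Proof.
move=> cm ml ab; exists a, b; split=> //.
exact: (join_incl (i := m)).
Qed.

Lemma restrict_le (X : topologicalType) (le le' : rel_family X) (A : set X) x y :
  rel_family_le le le' -> restrict le A x y -> restrict le' A x y.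
Proof.
move=> ll [a [b [<- <- ab]]]; exists a, b; split=> //.
apply: join_min ab; first exact: join_preorder.
  move=> m [cm ml] c Ac; exists m => //; split=> // U s t /ml[Us Ut st].
  by split=> // V UV; exact/ll/st.
move=> m [cm ml] c d cd.
apply: (join_incl (i := m)) => //; split=> // U s t /ml[Us Ut st].
by split=> // V UV; exact/ll/st.
Qed.

Lemma compact_hausdorff_subsets_cover (X : topologicalType) (A : set X) :
  \bigcup_(L in compact_hausdorff_subsets A) L = A.
Proof.
apply/seteqP; split=> [x [L [LA _] /LA]//|x Ax].
exists [set x] => //; split=> [_ ->//|]; exact: compact_hausdorff_set1.
Qed.

Lemma k_join_preorder (X : topologicalType) (le : rel_family X) (A : set X) :
  preorder_on A (join (compact_hausdorff_subsets A) id (restrict le)).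
Proof.
rewrite -{1}(compact_hausdorff_subsets_cover A); exact: join_preorder.
Qed.

(** The other half of the definition of a k-circulation is automatic, by
    [restrict_sub]. *)
Lemma k_circulation_criterion (X : topologicalType) (le : rel_family X) :
  circulation le ->
  (forall U x y, le U x y ->
     join (compact_hausdorff_subsets U) id (restrict le) x y) ->
  k_circulation le.
Proof.
move=> cl lej; split=> // U x y; split; first exact: lej.
apply: (join_min (cl.1 U)) => L [LU _] //.
move=> a b; apply: restrict_sub => //; exact: circulation_precirculation.
Qed.

Lemma k_join_incl (X : topologicalType) (le : rel_family X) (A L : set X) x y :
  compact_hausdorff_subsets A L -> restrict le L x y ->
  join (compact_hausdorff_subsets A) id (restrict le) x y.
Proof.
move=> AL xy; have [a [b [ax bx _]]] := xy.
apply: (join_incl (i := L)) => //; first by rewrite -ax; exact: set_valP.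
by rewrite -bx; exact: set_valP.
Qed.

(** The pointwise join, formed on [U] and not on a union of copies of [U]
    indexed by [Q], so that it is the discrete circulation when [Q] is empty. *)
Definition circ_join (X : topologicalType) (Q : set (rel_family X)) :
    rel_family X :=
  fun U => generated U (fun x y => exists2 le, Q le & le U x y).

Section CircJoin.
Variables (X : topologicalType) (Q : set (rel_family X)).

Lemma circ_join_min (U : opens X) (B : set X) (T : X -> X -> Prop) :
  preorder_on B T -> U `<=` B ->
  (forall le, Q le -> forall x y, le U x y -> T x y) ->
  forall x y, circ_join Q U x y -> T x y.
Proof.
move=> pT UB QT; apply: generated_min pT UB _ => x y [le /QT]; exact.
Qed.

Hypothesis Qcirc : forall le, Q le -> circulation le.

Lemma circ_join_incl le : Q le -> rel_family_le le (circ_join Q).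
Proof.
move=> Ql U x y xy; have [/(_ _ _ xy)[Ux Uy] _ _] := (Qcirc Ql).1 U.
by split=> //; apply: rt_step; exists le.
Qed.

Lemma circ_join_circulation : circulation (circ_join Q).
Proof.
have pre (U : opens X) : preorder_on U (circ_join Q U).
  exact: generated_preorder.
split=> // O x y; split.
  apply: (circ_join_min (@join_preorder _ _ _ _ _)) => // le Ql {}x {}y.
  move=> /(Qcirc Ql).2.
  apply: (join_min (@join_preorder _ _ _ _ _)).
    by move=> U OU z Uz; exists U.
  move=> U OU {}x {}y /(circ_join_incl Ql) xy.
  by have [Ux Uy _] := xy; exact: (join_incl (i := U)).
apply: (join_min (pre _)) => [U OU z Uz|U OU]; first by exists U.
have UO : U `<=` opens_bigcup O by move=> z Uz; exists U.
apply: (circ_join_min (pre _) UO) => le Ql {}x {}y xy.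
apply: (circ_join_incl Ql).
exact: (circulation_precirculation (Qcirc Ql)).2 UO _ _ xy.
Qed.

(** Each member is a join of its own restrictions, which are contained in the
    restrictions of the whole join. *)
Lemma circ_join_k_circulation :
  (forall le, Q le -> k_circulation le) -> k_circulation (circ_join Q).
Proof.
move=> Qk; apply: k_circulation_criterion circ_join_circulation _ => U.
apply: (circ_join_min (k_join_preorder _ _)) => // le Ql x y /(Qk _ Ql).2.
apply: (join_min (k_join_preorder _ _)) => L UL; first by case: UL.
move=> {}x {}y /(restrict_le (circ_join_incl Ql)); exact: k_join_incl.
Qed.

End CircJoin.

(** * Pushforward of circulations *)

Definition pushforward (X Y : topologicalType) (g : continuousType X Y)
    (le : rel_family X) : rel_family Y :=
  fun V => generated V (fun x y =>
    exists s t, [/\ le (opens_preimage g V) s t, g s = x & g t = y]).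

Section Pushforward.
Variables (X Y : topologicalType) (g : continuousType X Y) (le : rel_family X).

Lemma pushforward_min (V : opens Y) (B : set Y) (T : Y -> Y -> Prop) :
  preorder_on B T -> V `<=` B ->
  (forall s t, le (opens_preimage g V) s t -> T (g s) (g t)) ->
  forall x y, pushforward g le V x y -> T x y.
Proof.
by move=> pT VB gT; apply: generated_min pT VB _ => _ _ [s [t [/gT ? <- <-]]].
Qed.

Hypothesis cle : circulation le.

Lemma pushforward_incl (V : opens Y) s t :
  le (opens_preimage g V) s t -> pushforward g le V (g s) (g t).
Proof.
move=> st; have [/(_ _ _ st)[Vs Vt] _ _] := cle.1 (opens_preimage g V).
by split=> //; apply: rt_step; exists s, t.
Qed.

(** Taking preimages under [g] commutes with unions, so the gluing condition on
    [Y] is the one on [X] for the family of preimages. *)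
Lemma pushforward_circulation : circulation (pushforward g le).
Proof.
have pre (V : opens Y) : preorder_on V (pushforward g le V).
  exact: generated_preorder.
split=> // O x y; split.
  apply: (pushforward_min (@join_preorder _ _ _ _ _)) => // s t.
  have -> : opens_preimage g (opens_bigcup O) =
            opens_bigcup (opens_preimage g @` O).
    apply: opens_eq; apply/seteqP; split=> [z [V OV Vz]|z [_ [V OV <-] Vz]].
      by exists (opens_preimage g V) => //; exists V.
    by exists V.
  move=> /cle.2; apply: (join_min (preorder_preimage g (@join_preorder _ _ _ _ _))).
    by move=> _ [V OV <-] z Vz; exists V.
  move=> _ [V OV <-] {}s {}t /pushforward_incl st.
  by have [Vs Vt _] := st; exact: (join_incl (i := V)).
apply: (join_min (pre _)) => [V OV z Vz|V OV]; first by exists V.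
have VO : V `<=` opens_bigcup O by move=> z Vz; exists V.
apply: (pushforward_min (pre _) VO) => s t st; apply: pushforward_incl.
by apply: (circulation_precirculation cle).2 st => z; exact: VO.
Qed.

End Pushforward.

(** The substream on [L], pushed forward along the corestriction of [g] to
    [g @` L], is a circulation on [g @` L].  It is contained in the pullback of
    the pushforward along [g], hence in its cosheafification. *)
Lemma pushforward_restrict (X Y : topologicalType) (g : continuousType X Y)
    (le : rel_family X) (L : set X) s t :
  circulation le -> restrict le L s t ->
  restrict (pushforward g le) (g @` L) (g s) (g t).
Proof.
move=> cle [a [b [<- <- ab]]].
have gL (c : L) : g (set_val c) \in g @` L.
  by apply/mem_set; exists (set_val c) => //; exact: set_valP.
pose h0 (c : L) : g @` L := SigSub (gL c).
have ch0 : continuous h0.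
  apply/continuousP => _ [W oW <-].
  rewrite (_ : h0 @^-1` _ = (g \o (set_val : L -> X)) @^-1` W) //.
  have cgv : continuous (g \o (set_val : L -> X)).
    by apply: continuous_set_val; exact: cts_fun.
  by move/continuousP: cgv; apply.
pose h : continuousType L (g @` L) := mkcts ch0.
have cm := substream_circ_circulation L cle.
pose m := substream_circ le (A := L).
apply: (restrict_incl (m := pushforward h m) (a := h a) (b := h b)).
- exact: pushforward_circulation.
- have pp := pullback_precirculation (set_val : g @` L -> Y)
    (circulation_precirculation (pushforward_circulation g cle)).
  move=> W; apply: (pushforward_min (pp.1 W)) => // u v uv.
  have [/(_ _ _ uv)[Wu Wv] _ _] := cm.1 (opens_preimage h W).
  split=> // V WV; apply: (pushforward_incl cle).
  have pl := pullback_precirculation (set_val : L -> X)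
    (circulation_precirculation cle).
  have : pullback (set_val : L -> X) le (opens_preimage h W) u v.
    apply: (join_min (pl.1 (opens_preimage h W))) uv => l [_ ll].
      exact: subset_refl.
    exact: ll.
  by case=> _ _; apply=> _ [c Wc <-]; apply: WV; exists (h c).
- apply: pushforward_incl => //.
  by rewrite (_ : opens_preimage h _ = opens_full L) //; exact: opens_eq.
Qed.

(** A relation of the pushforward comes from a chain of relations on compact
    Hausdorff sets [L], and each of them is transported to [g @` L]. *)
Lemma pushforward_k_circulation (X Y : topologicalType)
    (g : continuousType X Y) (le : rel_family X) :
  weak_hausdorff Y -> k_circulation le -> k_circulation (pushforward g le).
Proof.
move=> wY [cle kle]; apply: k_circulation_criterion.
  exact: pushforward_circulation.
move=> V; apply: (pushforward_min (k_join_preorder _ _)) => // s t /kle.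
apply: (join_min (preorder_preimage g (k_join_preorder _ _))).
  by move=> L [].
move=> L [LV cL] {}s {}t /(pushforward_restrict g cle); apply: k_join_incl.
split; first by move=> _ [x /LV Vx <-].
by apply: compact_hausdorff_image => //; exact: cts_fun.
Qed.

(** * Initial structures *)

Theorem proposition5p8 : topological_functor forgetful.
Proof.
move=> J D [[X Xcg] f fnat].
pose admissible : set (rel_family X) := [set le | k_circulation le /\
  forall j, rel_family_le le (pullback (f j) (@stream_circ (D j)))].
have admc le : admissible le -> circulation le by case=> -[].
pose S := Stream (circ_join_circulation admc).
have kS : k_circulation (@stream_circ S).
  by apply: circ_join_k_circulation => // le [].
have fS j : is_stream_map (S := S) (T := D j) (f j).
  have pD := circulation_precirculation (@stream_circP (D j)).
  have pp := pullback_precirculation (f j) pD.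
  move=> U x y xy.
  suff: pullback (f j) (@stream_circ (D j)) (opens_preimage (f j) U) x y.
    by case=> _ _; apply=> _ [z Uz <-].
  by apply: (circ_join_min (pp.1 _)) xy => // le [_]; exact.
pose c : CFStreams := CFStream (cf_base := S) (conj Xcg kS).
pose l j : hom c (D j) := StreamMap (fS j).
have lnat i j (u : hom i j) : comp (fmap D u) (l i) = l j.
  exact/stream_map_eq/(fnat i j u).
exists (Cone lnat); split.
  (* The two cones differ only by their proofs that [X] is compactly generated
     and that the legs are natural. *)
  rewrite /map_cone; move: (map_cone_natural _ _) => /=.
  move: (proj1 _) => Pcg; rewrite (Prop_irrelevance Pcg Xcg) => nat'.
  by rewrite (Prop_irrelevance nat' fnat).
move=> c' g fg.
have gS : is_stream_map (S := apex c') (T := S) g.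
  have [_ [cS' kS']] := cf_baseP (apex c').
  have adm : admissible (pushforward g (@stream_circ (apex c'))).
    split; first exact: pushforward_k_circulation (proj1 Xcg) (conj cS' kS').
    move=> j; have pD := circulation_precirculation (@stream_circP (D j)).
    have pp := pullback_precirculation (f j) pD.
    move=> U; apply: (pushforward_min (pp.1 U)) => // s t st.
    have [/(_ _ _ st)[Us Ut] _ _] := cS'.1 (opens_preimage g U).
    split=> // V UV.
    have fgE z : f j (g z) = leg c' j z.
      by have /(congr1 (fun h : continuousType _ _ => h z)) := fg j.
    rewrite !fgE; apply: (@smap_funP (apex c') (D j) (leg c' j) V).
    apply: (circulation_precirculation cS').2 st => z Uz /=.
    by rewrite -fgE; apply: UV; exists (g z).
  by move=> U x y xy; apply: (circ_join_incl admc adm); exact: pushforward_incl.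
exists (StreamMap gS : hom (apex c') c); split.
  by split=> // j; exact/stream_map_eq/fg.
by move=> h [hg _]; exact/stream_map_eq.
Qed.
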